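(* Let $G$ be a finite abelian group with subgroups $G_1,\ldots,G_n$, and let $C$ be the corresponding quasi-uniform code of length $n$. Then the size of the code alphabet of $C$ is $\sum_{i=1}^n [G:G_i]$.
   Context: For a finite group $G$ with subgroups $G_1,\ldots,G_n$, the corresponding quasi-uniform code of length $n$ is $C=\{(gG_1,\ldots,gG_n): g\in G\}$, where $gG_i=\{gh: h\in G_i\}$ is the left coset of $G_i$ containing $g$. Equivalently, one forms the table with rows indexed by the elements $g$ of $G$ and columns indexed by $G_1,\ldots,G_n$, with entry $gG_i$ in row $g$ and column $G_i$; the rows are the codewords. The code alphabet is the set of cosets that appear in this table. $[G:G_i]=|G|/|G_i|$ denotes the index of $G_i$ in $G$.
   Formalization: The subgroups G_1,…,G_n are assumed pairwise distinct; with a repeated subgroup (e.g. G_1=G_2=G, where the set of cosets has 1 element but the sum is 2) the stated formula fails. *)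

(* Defs.v *)
From mathcomp Require Import all_boot all_fingroup.

Set Implicit Arguments.
Unset Strict Implicit.
Unset Printing Implicit Defensive.

Local Open Scope group_scope.

Definition quasi_uniform_code (gT : finGroupType) (n : nat) (G : {group gT})
    (H : 'I_n -> {group gT}) : {set {ffun 'I_n -> {set gT}}} :=
  [set [ffun i : 'I_n => g *: H i] | g in G].

(* The symbols occurring in any column of the code. For the code above these
   are cosets compared as subsets of the group, not tagged by their column. *)
Definition code_alphabet (A : finType) (n : nat) (C : {set {ffun 'I_n -> A}}) :
    {set A} :=
  [set c i | c : {ffun 'I_n -> A} in C, i : 'I_n in [set: 'I_n]].

(* Main.v *)
Require Import Defs.
From mathcomp Require Import all_boot all_fingroup.

Local Open Scope group_scope.

(** A left coset [xK] determines the subgroup [K], since [K = (xK)^-1 (xK)].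
    So left cosets of distinct subgroups are never equal as sets
    ([lcosets_disjoint]), and the alphabet, which is the union over [i] of the
    sets of left cosets of [H i] by elements of [G] ([code_alphabetE]), is,
    the [H i] being distinct, a disjoint union whose [i]-th part has
    [#|G : H i|] elements. *)

Lemma lcoset_inj_group (gT : finGroupType) (K L : {group gT}) (x y : gT) :
  x *: K = y *: L -> K = L.
Proof.
move=> eqKL.
have /lcosetP[l Ll Dx]: x \in y *: L by rewrite -eqKL lcoset_refl.
apply/val_inj/(@lcoset_inj _ x); rewrite /= eqKL Dx.
by apply/esym/lcoset_eqP; rewrite mem_lcoset mulKg.
Qed.

Lemma lcosets_disjoint (gT : finGroupType) (K L : {group gT}) (A : {set gT}) :
  K != L -> [disjoint lcosets K A & lcosets L A].
Proof.
move=> neqKL; apply/pred0P => X /=; apply/negbTE/negP.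
case/andP=> /lcosetsP[x _ ->] /lcosetsP[y _ eqKL].
by case/eqP: neqKL; apply: lcoset_inj_group eqKL.
Qed.

Lemma code_alphabetE (gT : finGroupType) (n : nat) (G : {group gT})
    (H : 'I_n -> {group gT}) :
  code_alphabet (quasi_uniform_code G H) = \bigcup_(i < n) lcosets (H i) G.
Proof.
apply/setP => X; apply/imset2P/bigcupP.
  case=> _ i /imsetP[g Gg ->] _ ->; exists i => //.
  by apply/lcosetsP; exists g; rewrite ?ffunE.
case=> i _ /lcosetsP[g Gg ->].
exists [ffun j : 'I_n => g *: H j] i; rewrite ?inE ?ffunE //.
exact: imset_f.
Qed.

Theorem lemma2 (gT : finGroupType) (n : nat) (G : {group gT})
    (H : 'I_n -> {group gT}) (abG : abelian G)
    (sHG : forall i : 'I_n, H i \subset G)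
    (distinctH : injective H) :
  #|code_alphabet (quasi_uniform_code G H)| = (\sum_(i < n) #|G : H i|)%N.
Proof.
rewrite code_alphabetE -sum1_card partition_disjoint_bigcup /=.
  by apply: eq_bigr => i _; rewrite sum1_card card_lcosets.
by move=> i j neq_ij; rewrite lcosets_disjoint // (inj_eq distinctH).
Qed.
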